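(* Let $a,b,h,a'',b''$ be smooth functions of $(u,v)$ on an open set $D\subset\mathbb{R}^2$, with $h$ nowhere zero, satisfying the integrability conditions $$ah=h_u,\quad a_v=ba''+h,\quad b_v+bb''=0,\quad h_v=b''h,\quad a''_u+aa''=0,\quad h=b''_u+a''b.$$ Consider, for one unknown function $\theta=\theta(u,v)$, the PDE system $$\theta_{uu}=a\theta_u+b\theta_v,\qquad \theta_{uv}=h\theta,\qquad \theta_{vv}=a''\theta_u+b''\theta_v.$$ Let $\bar G$ be the full symmetry group of this system and let $\bar G_1$ be the subgroup of $\bar G$ which acts on the space of the dependent variable $\theta$ (that is, whose infinitesimal generators have the form $\alpha(\theta)\frac{\partial}{\partial\theta}$). Then the Lie algebra of the infinitesimal symmetries associated to $\bar G_1$ is generated by the vector field $$\bar Y_1=\theta\frac{\partial}{\partial\theta}.$$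
   Context: The functions $a,b,h,a'',b''$ are five independent names (the double prime is not a derivative); subscripts $u,v$ denote partial derivatives. Symmetry groups: a symmetry group of a PDE system $\Delta_\nu(x,u^{(n)})=0$, $\nu=1,\dots,l$, in independent variables $x=(x^1,\dots,x^p)$ and dependent variables $u=(u^1,\dots,u^q)$ ($u^{(n)}$ denotes all derivatives of orders $0$ to $n$) is a local group of transformations acting on an open subset $M$ of the space of independent and dependent variables that transforms solutions into solutions. Its Lie algebra of infinitesimal generators (infinitesimal symmetries) is determined by the infinitesimal invariance condition: a vector field $X=\sum_i\zeta^i(x,u)\frac{\partial}{\partial x^i}+\sum_\alpha\phi_\alpha(x,u)\frac{\partial}{\partial u^\alpha}$ is an infinitesimal symmetry if $\mathrm{pr}^{(n)}X[\Delta_\nu(x,u^{(n)})]=0$ for all $\nu$ whenever $\Delta(x,u^{(n)})=0$, where $\mathrm{pr}^{(n)}X=X+\sum_\alpha\sum_J\phi_\alpha^J\frac{\partial}{\partial u^\alpha_J}$, the sum being over multi-indices of order $1\le |J|\le n$, and $\phi^J_\alpha=D_J\big(\phi_\alpha-\sum_i\zeta^iu^\alpha_i\big)+\sum_i\zeta^iu^\alpha_{J,i}$ with $D_J$ the total derivative. The full symmetry group is the one generated by all infinitesimal symmetries.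
   Formalization: The symmetries act on an open subset M of D × R whose set of θ-values is assumed to be an interval (true for M = D × R and for connected M); otherwise α(θ) = cθ with different constants c on different components of the θ-values is a counterexample. *)

(* Defs.v *)
(* Stdlib reals with Coquelicot. *)
From Stdlib Require Import Reals List.
From Coquelicot Require Import Coquelicot.

Open Scope R_scope.

(** * Smooth functions on an open set *)

Fixpoint iter_dir_deriv {V : NormedModule R_AbsRing} (ws : list V) (f : V -> R)
  : V -> R :=
  match ws with
  | nil => f
  | cons w ws' =>
      fun p => Derive (fun t : R => iter_dir_deriv ws' f (plus p (scal t w))) 0
  end.

(** On a finite-dimensional space this is the usual class of C^infinity
    functions on the open set [O]: all iterated directional derivatives (in
    particular all iterated partial derivatives) exist and are continuous. *)
Definition smooth_on {V : NormedModule R_AbsRing} (O : V -> Prop) (f : V -> R)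
  : Prop :=
  forall (ws : list V) (p : V), O p ->
    continuous (iter_dir_deriv ws f) p /\
    forall w : V,
      ex_derive (fun t : R => iter_dir_deriv ws f (plus p (scal t w))) 0.

Definition pd_u (f : R * R -> R) (x : R * R) : R :=
  Derive (fun s => f (s, snd x)) (fst x).
Definition pd_v (f : R * R -> R) (x : R * R) : R :=
  Derive (fun s => f (fst x, s)) (snd x).

(** * Vector fields on the space of independent and dependent variables

    A point [(u, v, theta)] is [((u, v), theta) : R * R * R]. *)

Record vector_field : Type := VF {
  zeta_u : R * R * R -> R;
  zeta_v : R * R * R -> R;
  phi : R * R * R -> R
}.

Definition vf_smooth_on (M : R * R * R -> Prop) (X : vector_field) : Prop :=
  smooth_on M (zeta_u X) /\ smooth_on M (zeta_v X) /\ smooth_on M (phi X).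

(** Coefficients are total functions; only their values on [M] matter. *)
Definition vf_eq_on (M : R * R * R -> Prop) (X Y : vector_field) : Prop :=
  forall p, M p ->
    zeta_u X p = zeta_u Y p /\ zeta_v X p = zeta_v Y p /\ phi X p = phi Y p.

Definition vf_zero : vector_field :=
  VF (fun _ => 0) (fun _ => 0) (fun _ => 0).
Definition vf_add (X Y : vector_field) : vector_field :=
  VF (fun p => zeta_u X p + zeta_u Y p)
     (fun p => zeta_v X p + zeta_v Y p)
     (fun p => phi X p + phi Y p).
Definition vf_scale (c : R) (X : vector_field) : vector_field :=
  VF (fun p => c * zeta_u X p) (fun p => c * zeta_v X p)
     (fun p => c * phi X p).

Definition vf_apply (X : vector_field) (f : R * R * R -> R) (p : R * R * R)
  : R :=
  let '(u, v, t) := p in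
  zeta_u X p * Derive (fun s => f (s, v, t)) u +
  zeta_v X p * Derive (fun s => f (u, s, t)) v +
  phi X p * Derive (fun s => f (u, v, s)) t.

Definition vf_bracket (X Y : vector_field) : vector_field :=
  VF (fun p => vf_apply X (zeta_u Y) p - vf_apply Y (zeta_u X) p)
     (fun p => vf_apply X (zeta_v Y) p - vf_apply Y (zeta_v X) p)
     (fun p => vf_apply X (phi Y) p - vf_apply Y (phi X) p).

(** The real Lie algebra of vector fields on [M] generated by [S]. *)
Inductive lie_generated (M : R * R * R -> Prop) (S : vector_field -> Prop)
  : vector_field -> Prop :=
| lie_gen X : S X -> lie_generated M S X
| lie_zero : lie_generated M S vf_zero
| lie_add X Y :
    lie_generated M S X -> lie_generated M S Y ->
    lie_generated M S (vf_add X Y)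
| lie_scale c X : lie_generated M S X -> lie_generated M S (vf_scale c X)
| lie_bracket X Y :
    lie_generated M S X -> lie_generated M S Y ->
    lie_generated M S (vf_bracket X Y)
| lie_eq_on X Y :
    lie_generated M S X -> vf_eq_on M X Y -> lie_generated M S Y.

(** * Jets and prolongation

    [jd j i k] is the coordinate for the derivative of [theta] taken [i] times
    in [u] and [k] times in [v], with [jd j 0 0] the value of [theta].  One type
    of jets serves for every order: a function of [(x, theta^(n))] is a function
    of [j] that uses only the coordinates with [i + k <= n]. *)

Record jet : Type := Jet { ju : R; jv : R; jd : nat -> nat -> R }.

Definition base (j : jet) : R * R * R := (ju j, jv j, jd j 0%nat 0%nat).

Definition jd_set (d : nat -> nat -> R) (i k : nat) (s : R) : nat -> nat -> R :=
  fun i' k' => if andb (Nat.eqb i' i) (Nat.eqb k' k) then s else d i' k'.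

Definition jet_pd_u (F : jet -> R) (j : jet) : R :=
  Derive (fun s => F (Jet s (jv j) (jd j))) (ju j).
Definition jet_pd_v (F : jet -> R) (j : jet) : R :=
  Derive (fun s => F (Jet (ju j) s (jd j))) (jv j).
Definition jet_pd_theta (i k : nat) (F : jet -> R) (j : jet) : R :=
  Derive (fun s => F (Jet (ju j) (jv j) (jd_set (jd j) i k s))) (jd j i k).

(** The sum of [G i k] over the multi-indices with [m <= i + k <= n]. *)
Definition sum_multi (G : nat -> nat -> R) (m n : nat) : R :=
  sum_n_m (fun r : nat => sum_n_m (fun i : nat => G i (r - i)%nat) 0 r) m n.

(** Total derivatives of functions of [(x, theta^(n))]. *)
Definition total_u (n : nat) (F : jet -> R) (j : jet) : R :=
  jet_pd_u F j +
  sum_multi (fun i k => jd j (S i) k * jet_pd_theta i k F j) 0 n.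
Definition total_v (n : nat) (F : jet -> R) (j : jet) : R :=
  jet_pd_v F j +
  sum_multi (fun i k => jd j i (S k) * jet_pd_theta i k F j) 0 n.

Definition characteristic (X : vector_field) (j : jet) : R :=
  phi X (base j) - (zeta_u X (base j) * jd j 1%nat 0%nat
                    + zeta_v X (base j) * jd j 0%nat 1%nat).

(** The coefficient [phi^J], [J = (i, k)].  When [1 <= i + k <= n] every
    function to which a total derivative is applied here has order at most [n],
    so truncating the total derivatives at order [n] loses nothing. *)
Definition phi_J (n : nat) (X : vector_field) (i k : nat) (j : jet) : R :=
  Nat.iter i (total_u n) (Nat.iter k (total_v n) (characteristic X)) j
  + (zeta_u X (base j) * jd j (S i) k + zeta_v X (base j) * jd j i (S k)).

(** [pr^(n) X [F]]. *)
Definition prolong (n : nat) (X : vector_field) (F : jet -> R) (j : jet) : R :=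
  zeta_u X (base j) * jet_pd_u F j
  + zeta_v X (base j) * jet_pd_v F j
  + phi X (base j) * jet_pd_theta 0 0 F j
  + sum_multi (fun i k => phi_J n X i k j * jet_pd_theta i k F j) 1 n.

Definition infinitesimal_symmetry (n : nat) (M : R * R * R -> Prop)
    (Delta : list (jet -> R)) (X : vector_field) : Prop :=
  vf_smooth_on M X /\
  forall F, In F Delta ->
  forall j, M (base j) -> (forall G, In G Delta -> G j = 0) ->
    prolong n X F j = 0.

(** * The system and the subgroup acting on the dependent variable *)

Definition pde_system (a b h a'' b'' : R * R -> R) : list (jet -> R) :=
  (fun j => jd j 2 0 - (a (ju j, jv j) * jd j 1 0 + b (ju j, jv j) * jd j 0 1))
  :: (fun j => jd j 1 1 - h (ju j, jv j) * jd j 0 0)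
  :: (fun j => jd j 0 2
               - (a'' (ju j, jv j) * jd j 1 0 + b'' (ju j, jv j) * jd j 0 1))
  :: nil.

Definition theta_field (alpha : R -> R) : vector_field :=
  VF (fun _ => 0) (fun _ => 0) (fun p => alpha (snd p)).

Definition lie_algebra_G1 (M : R * R * R -> Prop) (Delta : list (jet -> R))
    (X : vector_field) : Prop :=
  infinitesimal_symmetry 2 M Delta X /\
  exists alpha : R -> R, vf_eq_on M X (theta_field alpha).

Definition Y1 : vector_field := theta_field (fun t => t).

(** The set of values of [theta] on [M] is an interval, as it is when [M] is
    connected and when [M] is [D * R].  Over a disconnected set of values a
    function of [theta] alone can be chosen independently on each component. *)
Definition theta_range_interval (M : R * R * R -> Prop) : Prop :=
  forall (x1 x2 : R * R) (t1 t t2 : R),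
    M (x1, t1) -> M (x2, t2) -> t1 <= t <= t2 -> exists x, M (x, t).

(* Main.v *)
(** On fields [alpha(theta) d/dtheta] the second prolongation has
    [phi^(uv) = alpha'' theta_u theta_v + alpha' theta_uv], so invariance of
    [theta_uv = h theta] reads
    [alpha'' theta_u theta_v + h (alpha' theta - alpha) = 0] with [theta_u],
    [theta_v] free.  Hence [alpha'' = 0] and, [h] being nonzero,
    [alpha = theta alpha'], i.e. [alpha] is linear.  Conversely the prolongation
    of [c theta d/dtheta] multiplies each of the (linear) equations by [c]. *)
Require Import Defs.
From Stdlib Require Import Reals List Lra Lia Classical.
From Coquelicot Require Import Coquelicot.

Open Scope R_scope.

(** * Smoothness on open sets: locality and linear functions *)

Lemma locally_line {V : NormedModule R_AbsRing} (O : V -> Prop) (p w : V) :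
  open O -> O p -> locally 0 (fun t : R => O (plus p (scal t w))).
Proof.
  intros HO Hp.
  assert (Hc : continuous (fun t : R => plus p (scal t w)) 0).
  { apply (continuous_plus (fun _ : R => p) (fun t : R => scal t w)).
    - apply continuous_const.
    - apply (continuous_scal_l (fun t : R => t) w). apply continuous_id. }
  apply Hc. apply HO.
  replace (plus p (scal 0 w)) with p; [exact Hp|].
  rewrite <- (plus_zero_r p) at 1. f_equal.
  symmetry. apply (scal_zero_l w).
Qed.

(** A short segment of each line through a point of [O] stays in the open set [O], so every
    directional derivative there sees only the values on [O]. *)
Lemma iter_dir_deriv_ext {V : NormedModule R_AbsRing} (O : V -> Prop)
    (f g : V -> R) (ws : list V) :
  open O -> (forall p, O p -> f p = g p) ->
  forall p, O p -> iter_dir_deriv ws f p = iter_dir_deriv ws g p.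
Proof.
  intros HO Hfg; induction ws as [|w ws IH]; simpl; [exact Hfg|].
  intros p Hp. apply Derive_ext_loc.
  generalize (locally_line O p w HO Hp). apply filter_imp. auto.
Qed.

Lemma smooth_on_ext {V : NormedModule R_AbsRing} (O : V -> Prop)
    (f g : V -> R) :
  open O -> (forall p, O p -> f p = g p) -> smooth_on O f -> smooth_on O g.
Proof.
  intros HO Hfg Hf ws p Hp.
  destruct (Hf ws p Hp) as [Hc Hd].
  assert (E := iter_dir_deriv_ext O f g ws HO Hfg).
  split.
  - apply (continuous_ext_loc _ (iter_dir_deriv ws f)); [|exact Hc].
    generalize (HO p Hp). apply filter_imp. exact E.
  - intros w. apply (ex_derive_ext_loc (fun t : R =>
      iter_dir_deriv ws f (plus p (scal t w)))); [|apply Hd].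
    generalize (locally_line O p w HO Hp). apply filter_imp. auto.
Qed.

Lemma smooth_on_linear {V : NormedModule R_AbsRing} (O : V -> Prop)
    (l : V -> R) :
  is_linear l -> smooth_on O l.
Proof.
  intros Hl.
  assert (Hline : forall k d p w t,
            k * l (plus p (scal t w)) + d = k * (l p + t * l w) + d).
  { intros. rewrite (linear_plus l Hl), (linear_scal l Hl). reflexivity. }
  (* The form [k * l p + d] is stable under differentiation: it starts at [k = 1], [d = 0], and one
     derivative along [w] leaves the constant [k * l w]. *)
  assert (Haff : forall ws, exists k d,
            forall p, iter_dir_deriv ws l p = k * l p + d).
  { induction ws as [|w ws [k [d IH]]]; simpl.
    - exists 1, 0. intros; ring.
    - exists 0, (k * l w). intros p.
      rewrite (Derive_ext _ (fun t => k * (l p + t * l w) + d)).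
      + apply is_derive_unique. auto_derive; [easy|ring].
      + intros t. now rewrite IH, Hline. }
  intros ws p _. destruct (Haff ws) as [k [d E]]. split.
  - apply (continuous_ext (fun p => k * l p + d)); [intros; now rewrite E|].
    apply (continuous_plus (fun p => k * l p) (fun _ => d)).
    + apply (continuous_scal_r k l). apply linear_cont, Hl.
    + apply continuous_const.
  - intros w. apply (ex_derive_ext (fun t => k * (l p + t * l w) + d)).
    + intros t. now rewrite E, Hline.
    + auto_derive. easy.
Qed.

(** * Prolongation depends only on the values of the field over [M] *)

Lemma locally_u (M : R * R * R -> Prop) u v t :
  open M -> M (u, v, t) -> locally u (fun s => M (s, v, t)).
Proof.
  intros HM H. destruct (HM _ H) as [e He]. exists e. intros s Hs.
  apply He. repeat split; [exact Hs|apply ball_center..].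
Qed.

Lemma locally_v (M : R * R * R -> Prop) u v t :
  open M -> M (u, v, t) -> locally v (fun s => M (u, s, t)).
Proof.
  intros HM H. destruct (HM _ H) as [e He]. exists e. intros s Hs.
  apply He. repeat split; [apply ball_center|exact Hs|apply ball_center].
Qed.

Lemma locally_theta (M : R * R * R -> Prop) u v t :
  open M -> M (u, v, t) -> locally t (fun s => M (u, v, s)).
Proof.
  intros HM H. destruct (HM _ H) as [e He]. exists e. intros s Hs.
  apply He. repeat split; [apply ball_center..|exact Hs].
Qed.

Lemma sum_multi_ext (G H : nat -> nat -> R) m n :
  (forall i k, G i k = H i k) -> sum_multi G m n = sum_multi H m n.
Proof.
  intros E. apply sum_n_m_ext; intros r. apply sum_n_m_ext; intros i. apply E.
Qed.

Lemma sum_multi_0_2 (G : nat -> nat -> R) :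
  sum_multi G 0 2 =
  G 0%nat 0%nat + G 0%nat 1%nat + G 1%nat 0%nat
  + G 0%nat 2%nat + G 1%nat 1%nat + G 2%nat 0%nat.
Proof.
  unfold sum_multi.
  repeat first [rewrite sum_n_n | rewrite sum_n_Sm by lia].
  simpl. unfold plus; simpl. ring.
Qed.

Lemma sum_multi_1_2 (G : nat -> nat -> R) :
  sum_multi G 1 2 =
  G 0%nat 1%nat + G 1%nat 0%nat
  + G 0%nat 2%nat + G 1%nat 1%nat + G 2%nat 0%nat.
Proof.
  unfold sum_multi.
  repeat first [rewrite sum_n_n | rewrite sum_n_Sm by lia].
  simpl. unfold plus; simpl. ring.
Qed.

Definition jet_eq_on (M : R * R * R -> Prop) (F G : jet -> R) : Prop :=
  forall j, M (base j) -> F j = G j.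

(** Only the slot [(0, 0)] moves the base point, and there openness of [M] in the [theta] direction
    is used. Varying any other slot keeps the jet over the same point of [M]. *)
Lemma jet_pd_theta_ext (M : R * R * R -> Prop) F G i k j :
  open M -> jet_eq_on M F G -> M (base j) ->
  jet_pd_theta i k F j = jet_pd_theta i k G j.
Proof.
  intros HM E Hj. apply Derive_ext_loc. destruct i as [|i]; [destruct k as [|k]|].
  - generalize (locally_theta M _ _ _ HM Hj). apply filter_imp.
    intros s Hs. apply E. exact Hs.
  - apply filter_forall. intros s. apply E. exact Hj.
  - apply filter_forall. intros s. apply E. exact Hj.
Qed.

Lemma total_u_ext (M : R * R * R -> Prop) n F G :
  open M -> jet_eq_on M F G -> jet_eq_on M (total_u n F) (total_u n G).
Proof.
  intros HM E j Hj. unfold total_u. f_equal.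
  - apply Derive_ext_loc. generalize (locally_u M _ _ _ HM Hj).
    apply filter_imp. intros s Hs. apply E. exact Hs.
  - apply sum_multi_ext. intros i k. f_equal.
    now apply (jet_pd_theta_ext M).
Qed.

Lemma total_v_ext (M : R * R * R -> Prop) n F G :
  open M -> jet_eq_on M F G -> jet_eq_on M (total_v n F) (total_v n G).
Proof.
  intros HM E j Hj. unfold total_v. f_equal.
  - apply Derive_ext_loc. generalize (locally_v M _ _ _ HM Hj).
    apply filter_imp. intros s Hs. apply E. exact Hs.
  - apply sum_multi_ext. intros i k. f_equal.
    now apply (jet_pd_theta_ext M).
Qed.

Lemma iter_jet_eq_on (M : R * R * R -> Prop)
    (T : (jet -> R) -> (jet -> R)) :
  (forall F G, jet_eq_on M F G -> jet_eq_on M (T F) (T G)) ->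
  forall n F G, jet_eq_on M F G ->
  jet_eq_on M (Nat.iter n T F) (Nat.iter n T G).
Proof.
  intros HT n F G E. induction n as [|n IH]; [exact E|]. apply HT, IH.
Qed.

(** Coefficients off [M] are arbitrary; this allows replacing a field by its model
    [theta_field alpha], known to agree with it on [M] alone. *)
Lemma prolong_ext (M : R * R * R -> Prop) n X Y F j :
  open M -> vf_eq_on M X Y -> M (base j) ->
  prolong n X F j = prolong n Y F j.
Proof.
  intros HM E Hj.
  assert (Hchar : jet_eq_on M (characteristic X) (characteristic Y)).
  { intros j' Hj'. unfold characteristic.
    destruct (E _ Hj') as [-> [-> ->]]. reflexivity. }
  unfold prolong. destruct (E _ Hj) as [Eu [Ev Ep]]. rewrite Eu, Ev, Ep.
  f_equal. apply sum_multi_ext. intros i k. f_equal. unfold phi_J.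
  rewrite Eu, Ev. f_equal.
  apply (iter_jet_eq_on M); [intros; now apply total_u_ext| |exact Hj].
  apply (iter_jet_eq_on M); [intros; now apply total_v_ext|exact Hchar].
Qed.

Lemma infinitesimal_symmetry_ext (M : R * R * R -> Prop) n Delta X Y :
  open M -> vf_eq_on M X Y ->
  infinitesimal_symmetry n M Delta X -> infinitesimal_symmetry n M Delta Y.
Proof.
  intros HM E [[Su [Sv Sp]] HX]. split.
  - split; [|split];
      [apply (smooth_on_ext M (zeta_u X))|apply (smooth_on_ext M (zeta_v X))
      |apply (smooth_on_ext M (phi X))]; auto; intros p Hp; now apply E.
  - intros F HF j Hj HD. rewrite <- (prolong_ext M n X Y); auto.
Qed.

(** * Second prolongation of fields in the [theta] direction *)

(* [Derive] is total and commutes unconditionally with scalar multiplication,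
   so no differentiability of [alpha] is needed. *)
Lemma total_u_theta (A : R -> R) j :
  total_u 2 (fun j => A (jd j 0 0)) j
  = Derive A (jd j 0 0) * jd j 1 0.
Proof.
  unfold total_u. rewrite sum_multi_0_2.
  unfold jet_pd_u, jet_pd_theta, jd_set; simpl.
  rewrite !Derive_const. change (fun s : R => A s) with A. ring.
Qed.

Lemma total_v_theta (A : R -> R) j :
  total_v 2 (fun j => A (jd j 0 0)) j
  = Derive A (jd j 0 0) * jd j 0 1.
Proof.
  unfold total_v. rewrite sum_multi_0_2.
  unfold jet_pd_v, jet_pd_theta, jd_set; simpl.
  rewrite !Derive_const. change (fun s : R => A s) with A. ring.
Qed.

(** This product rule and the next two cover all second-order coefficients, because [phi_J] computes
    the mixed one as [total_u] after [total_v]. *)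
Lemma total_u_theta_mul_10 (A : R -> R) j :
  total_u 2 (fun j => A (jd j 0 0) * jd j 1 0) j
  = Derive A (jd j 0 0) * jd j 1 0 * jd j 1 0
    + A (jd j 0 0) * jd j 2 0.
Proof.
  unfold total_u. rewrite sum_multi_0_2.
  unfold jet_pd_u, jet_pd_theta, jd_set; simpl.
  rewrite !Derive_const, Derive_scal_l, Derive_scal, Derive_id.
  change (fun s : R => A s) with A. ring.
Qed.

Lemma total_u_theta_mul_01 (A : R -> R) j :
  total_u 2 (fun j => A (jd j 0 0) * jd j 0 1) j
  = Derive A (jd j 0 0) * jd j 1 0 * jd j 0 1
    + A (jd j 0 0) * jd j 1 1.
Proof.
  unfold total_u. rewrite sum_multi_0_2.
  unfold jet_pd_u, jet_pd_theta, jd_set; simpl.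
  rewrite !Derive_const, Derive_scal_l, Derive_scal, Derive_id.
  change (fun s : R => A s) with A. ring.
Qed.

Lemma total_v_theta_mul_01 (A : R -> R) j :
  total_v 2 (fun j => A (jd j 0 0) * jd j 0 1) j
  = Derive A (jd j 0 0) * jd j 0 1 * jd j 0 1
    + A (jd j 0 0) * jd j 0 2.
Proof.
  unfold total_v. rewrite sum_multi_0_2.
  unfold jet_pd_v, jet_pd_theta, jd_set; simpl.
  rewrite !Derive_const, Derive_scal_l, Derive_scal, Derive_id.
  change (fun s : R => A s) with A. ring.
Qed.

Lemma prolong_theta_field (alpha : R -> R) F j :
  prolong 2 (theta_field alpha) F j =
  let t := jd j 0 0 in
  let p := jd j 1 0 in
  let q := jd j 0 1 in
  let d1 := Derive alpha t in
  let d2 := Derive (Derive alpha) t in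
  alpha t * jet_pd_theta 0 0 F j
  + d1 * p * jet_pd_theta 1 0 F j
  + d1 * q * jet_pd_theta 0 1 F j
  + (d2 * p * p + d1 * jd j 2 0) * jet_pd_theta 2 0 F j
  + (d2 * p * q + d1 * jd j 1 1) * jet_pd_theta 1 1 F j
  + (d2 * q * q + d1 * jd j 0 2) * jet_pd_theta 0 2 F j.
Proof.
  (* Over the whole space the locality lemmas act as extensionality: closed forms of first total
     derivatives can be substituted under a second one. *)
  set (T := fun _ : R * R * R => True).
  assert (HT : open T) by apply open_true.
  assert (E0 : jet_eq_on T (characteristic (theta_field alpha))
                 (fun j => alpha (jd j 0 0))).
  { intros j' _. unfold characteristic; simpl. ring. }
  assert (Eu : jet_eq_on T (total_u 2 (characteristic (theta_field alpha)))
                 (fun j => Derive alpha (jd j 0 0) * jd j 1 0)).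
  { intros j' Hj'. rewrite (total_u_ext T _ _ _ HT E0 j' Hj').
    apply total_u_theta. }
  assert (Ev : jet_eq_on T (total_v 2 (characteristic (theta_field alpha)))
                 (fun j => Derive alpha (jd j 0 0) * jd j 0 1)).
  { intros j' Hj'. rewrite (total_v_ext T _ _ _ HT E0 j' Hj').
    apply total_v_theta. }
  unfold prolong. rewrite sum_multi_1_2. unfold phi_J; simpl Nat.iter.
  rewrite (Eu j I), (Ev j I), (total_u_ext T _ _ _ HT Eu j I),
    (total_u_ext T _ _ _ HT Ev j I), (total_v_ext T _ _ _ HT Ev j I).
  rewrite total_u_theta_mul_10, total_u_theta_mul_01, total_v_theta_mul_01.
  simpl. ring.
Qed.

Lemma prolong_theta_field_uv (alpha : R -> R) (h : R * R -> R) j :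
  prolong 2 (theta_field alpha)
    (fun j => jd j 1 1 - h (ju j, jv j) * jd j 0 0) j =
  Derive (Derive alpha) (jd j 0 0) * jd j 1 0 * jd j 0 1
  + Derive alpha (jd j 0 0) * jd j 1 1
  - h (ju j, jv j) * alpha (jd j 0 0).
Proof.
  rewrite prolong_theta_field. cbv zeta.
  unfold jet_pd_theta, jd_set; simpl.
  rewrite !Derive_const.
  rewrite Derive_minus, !Derive_const, Derive_scal, Derive_id;
    [|auto_derive; easy..].
  rewrite Derive_minus, !Derive_const, Derive_id; [|auto_derive; easy..].
  ring.
Qed.

(** Each equation is homogeneous of degree one in [theta] and its derivatives, and the prolonged
    field acts on it as [c] times the Euler operator. The identity holds on all jets, solutions or
    not. *)
Lemma prolong_linear_field (a b h a'' b'' : R * R -> R) c F j :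
  In F (pde_system a b h a'' b'') ->
  prolong 2 (theta_field (fun t => c * t)) F j = c * F j.
Proof.
  assert (E1 : forall t, Derive (fun t => c * t) t = c).
  { intros t. now rewrite Derive_scal, Derive_id, Rmult_1_r. }
  assert (E2 : forall t, Derive (Derive (fun t => c * t)) t = 0).
  { intros t. rewrite (Derive_ext _ (fun _ => c)) by exact E1.
    apply Derive_const. }
  intros HF. rewrite prolong_theta_field. cbv zeta. rewrite E1, E2.
  unfold jet_pd_theta, jd_set.
  destruct HF as [<-|[<-|[<-|[]]]]; simpl;
    (* Each remaining slot derivative is of an affine function; its value is left as an existential
       variable that [auto_derive] fills in. *)
    repeat match goal with
    | |- context [Derive ?f ?x] =>
        let d := fresh "d" in
        let H := fresh "H" in
        evar (d : R);
        assert (H : Derive f x = d)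
          by (apply is_derive_unique; auto_derive;
              [easy|unfold d; reflexivity]);
        rewrite H; unfold d; clear H d
    end; ring.
Qed.

(** * The Lie algebra generated by [Y1] *)

(** The [theta] component is [c * t * d - d * t * c]. The [u] and [v] derivatives need no
    evaluation, since their factors [zeta_u] and [zeta_v] vanish on [M]. *)
Lemma vf_bracket_multiples (M : R * R * R -> Prop) X Y c d :
  open M ->
  vf_eq_on M X (theta_field (fun t => c * t)) ->
  vf_eq_on M Y (theta_field (fun t => d * t)) ->
  vf_eq_on M (vf_bracket X Y) vf_zero.
Proof.
  intros HM EX EY [[u v] t] Hp.
  destruct (EX _ Hp) as [Xu [Xv Xp]]. destruct (EY _ Hp) as [Yu [Yv Yp]].
  simpl in Xu, Xv, Xp, Yu, Yv, Yp.
  pose proof (locally_theta M u v t HM Hp) as L.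
  assert (D0 : forall f : R * R * R -> R, (forall p, M p -> f p = 0) ->
            Derive (fun s => f (u, v, s)) t = 0).
  { intros f Hf. rewrite (Derive_ext_loc _ (fun _ => 0)).
    - apply Derive_const.
    - revert L. apply filter_imp. auto. }
  assert (D1 : forall (f : R * R * R -> R) k,
            (forall p, M p -> f p = k * snd p) ->
            Derive (fun s => f (u, v, s)) t = k).
  { intros f k Hf. rewrite (Derive_ext_loc _ (fun s => k * s)).
    - rewrite Derive_scal, Derive_id. ring.
    - revert L. apply filter_imp. intros s Hs. now rewrite Hf. }
  simpl. rewrite Xu, Xv, Xp, Yu, Yv, Yp.
  rewrite (D0 (zeta_u X)), (D0 (zeta_u Y)), (D0 (zeta_v X)), (D0 (zeta_v Y)),
    (D1 (phi X) c), (D1 (phi Y) d)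
    by (intros p Hq; try apply (EX p Hq); apply (EY p Hq)).
  repeat split; ring.
Qed.

(** The multiples of one field commute, so closing under brackets adds nothing to the line they
    span. *)
Lemma lie_generated_Y1_iff (M : R * R * R -> Prop) X :
  open M ->
  lie_generated M (fun Y => Y = Y1) X <->
  exists c, vf_eq_on M X (theta_field (fun t => c * t)).
Proof.
  intros HM. split.
  - induction 1 as [X ->| |X Y _ [c EX] _ [d EY]|k X _ [c EX]
                   |X Y _ [c EX] _ [d EY]|X Y _ [c EX] E].
    + exists 1. intros p _. simpl. repeat split; ring.
    + exists 0. intros p _. simpl. repeat split; ring.
    + exists (c + d). intros p Hp. simpl.
      destruct (EX p Hp) as [-> [-> ->]]. destruct (EY p Hp) as [-> [-> ->]].
      simpl. repeat split; ring.
    + exists (k * c). intros p Hp. simpl.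
      destruct (EX p Hp) as [-> [-> ->]]. simpl. repeat split; ring.
    + exists 0. intros p Hp.
      destruct (vf_bracket_multiples M X Y c d HM EX EY p Hp) as [-> [-> ->]].
      simpl. repeat split; ring.
    + exists c. intros p Hp.
      destruct (E p Hp) as [<- [<- <-]]. exact (EX p Hp).
  - intros [c E]. apply (lie_eq_on M _ (vf_scale c Y1)).
    + apply lie_scale, lie_gen. reflexivity.
    + intros p Hp. destruct (E p Hp) as [-> [-> ->]].
      simpl. repeat split; ring.
Qed.

(** * Linear fields are symmetries; determining equations for [alpha] *)

Lemma linear_field_symmetry (M : R * R * R -> Prop)
    (a b h a'' b'' : R * R -> R) c :
  infinitesimal_symmetry 2 M (pde_system a b h a'' b'')
    (theta_field (fun t => c * t)).
Proof.
  split.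
  - assert (Z : smooth_on M (fun _ => 0)).
    { apply smooth_on_linear.
      exact (@is_linear_zero R_AbsRing _ R_NormedModule). }
    split; [exact Z|split; [exact Z|]].
    apply (smooth_on_linear M (fun p => c * snd p)).
    apply (is_linear_comp snd (fun t : R => c * t)).
    + apply is_linear_snd.
    + exact (is_linear_scal_r (V := R_NormedModule) c Rmult_comm).
  - intros F HF j _ HD. rewrite (prolong_linear_field a b h a'' b'') by auto.
    rewrite HD by auto. ring.
Qed.

(** Smoothness is given for a coefficient on [M], not for [alpha]; it is transferred by
    differentiating along the [theta] axis [w], once for [alpha] and twice for its derivative. *)
Lemma smooth_theta_ex_derive (M : R * R * R -> Prop) (f : R * R * R -> R)
    (alpha : R -> R) x t :
  open M -> smooth_on M f -> (forall p, M p -> f p = alpha (snd p)) ->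
  M (x, t) -> ex_derive alpha t /\ ex_derive (Derive alpha) t.
Proof.
  intros HM Hf E Hxt.
  assert (Hg : smooth_on M (fun p => alpha (snd p)))
    by exact (smooth_on_ext M f _ HM E Hf).
  set (w := ((0, 0), 1) : R * R * R).
  (* Directional derivatives are taken at parameter 0 along a line; this recentres them at [t]. *)
  assert (Hshift : forall g : R -> R,
            ex_derive (fun s => g (t + s * 1)) 0 -> ex_derive g t).
  { intros g Hs.
    apply (ex_derive_ext (fun r => g (t + (r - t) * 1))).
    - intros r. f_equal. ring.
    - apply (ex_derive_comp (fun s => g (t + s * 1)) (fun r => r - t)).
      + now replace (t - t) with 0 by ring.
      + auto_derive. easy. }
  split; apply Hshift.
  - destruct (Hg nil (x, t) Hxt) as [_ Hd]. exact (Hd w).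
  - destruct (Hg (w :: nil) (x, t) Hxt) as [_ Hd]. specialize (Hd w).
    revert Hd. apply ex_derive_ext. intros s. simpl.
    unfold plus, scal, mult; simpl. unfold mult; simpl.
    set (y := t + s * 1).
    transitivity (Derive (fun r => alpha (r + y)) 0).
    + apply Derive_ext. intros r. f_equal. ring.
    (* Both sides are limits of the same difference quotient, so the translation is valid whether or
       not [alpha] is differentiable at [y]. *)
    + unfold Derive. f_equal. apply Lim_ext. intros r.
      replace (0 + r + y) with (y + r) by ring. now rewrite Rplus_0_l.
Qed.

(** Convexity of [T] keeps every point between [s] and [t] inside the set where the derivative is
    known to vanish. *)
Lemma constant_of_derive_zero (T : R -> Prop) (f : R -> R) :
  (forall t1 t t2, T t1 -> T t2 -> t1 <= t <= t2 -> T t) ->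
  (forall t, T t -> ex_derive f t /\ Derive f t = 0) ->
  forall s t, T s -> T t -> f s = f t.
Proof.
  intros HT Hf.
  assert (Hlt : forall s t, s < t -> T s -> T t -> f s = f t).
  { intros s t Hst Hs Ht. apply (eq_is_derive f s t); [|exact Hst].
    intros r Hr. destruct (Hf r (HT s r t Hs Ht Hr)) as [He Hd].
    change zero with 0. rewrite <- Hd. now apply Derive_correct. }
  intros s t Hs Ht. destruct (Rtotal_order s t) as [H|[->|H]].
  - now apply Hlt.
  - reflexivity.
  - symmetry. now apply Hlt.
Qed.

Lemma theta_symmetry_determining (M : R * R * R -> Prop)
    (a b h a'' b'' : R * R -> R) (alpha : R -> R) X x t :
  open M -> infinitesimal_symmetry 2 M (pde_system a b h a'' b'') X ->
  vf_eq_on M X (theta_field alpha) -> M (x, t) -> h x <> 0 ->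
  Derive (Derive alpha) t = 0 /\ alpha t = Derive alpha t * t.
Proof.
  intros HM [_ HX] E Hxt Hh. destruct x as [u v].
  assert (Hpq : forall p q,
    Derive (Derive alpha) t * p * q + Derive alpha t * (h (u, v) * t)
    - h (u, v) * alpha t = 0).
  { intros p q.
    (* The values of [theta], [theta_u], [theta_v] are free parameters [t], [p], [q]; the
       second-order slots are solved from the three equations, so [j] lies on the system. *)
    set (j := Jet u v (fun i k => match i, k with
      | 0%nat, 0%nat => t
      | 1%nat, 0%nat => p
      | 0%nat, 1%nat => q
      | 2%nat, 0%nat => a (u, v) * p + b (u, v) * q
      | 1%nat, 1%nat => h (u, v) * t
      | 0%nat, 2%nat => a'' (u, v) * p + b'' (u, v) * q
      | _, _ => 0
      end)).
    rewrite <- (HX (fun j => jd j 1 1 - h (ju j, jv j) * jd j 0 0)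
      (or_intror (or_introl eq_refl)) j Hxt).
    - rewrite (prolong_ext M 2 X _ _ j HM E Hxt), prolong_theta_field_uv.
      reflexivity.
    - intros G [<-|[<-|[<-|[]]]]; simpl; ring. }
  (* At [p = q = 0] the quadratic term drops out; the difference with [p = q = 1] is the second
     derivative of [alpha]. *)
  assert (H0 := Hpq 0 0). assert (H1 := Hpq 1 1). split; [lra|].
  apply (Rmult_eq_reg_l (h (u, v))); [lra|exact Hh].
Qed.

Theorem theorem6
  (D : R * R -> Prop) (a b h a'' b'' : R * R -> R)
  (HD : open D)
  (Ha : smooth_on D a) (Hb : smooth_on D b) (Hh : smooth_on D h)
  (Ha'' : smooth_on D a'') (Hb'' : smooth_on D b'')
  (Hh0 : forall x, D x -> h x <> 0)
  (Hint : forall x, D x ->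
     a x * h x = pd_u h x /\
     pd_v a x = b x * a'' x + h x /\
     pd_v b x + b x * b'' x = 0 /\
     pd_v h x = b'' x * h x /\
     pd_u a'' x + a x * a'' x = 0 /\
     h x = pd_u b'' x + a'' x * b x)
  (M : R * R * R -> Prop)
  (HM : open M) (HMD : forall x t, M (x, t) -> D x)
  (HMt : theta_range_interval M) :
  forall X : vector_field,
    lie_algebra_G1 M (pde_system a b h a'' b'') X <->
    lie_generated M (fun Y => Y = Y1) X.
Proof.
  intros X. rewrite (lie_generated_Y1_iff M X HM). split.
  - intros [HX [alpha E]].
    (* [alpha] is constrained only at the values that [theta] takes on [M], and [HMt] makes this set
       an interval. *)
    set (T := fun t : R => exists x, M (x, t)).
    assert (Hdet : forall t, T t ->
              Derive (Derive alpha) t = 0 /\ alpha t = Derive alpha t * t).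
    { intros t [x Hxt].
      apply (theta_symmetry_determining M a b h a'' b'' alpha X x t); auto.
      apply Hh0, (HMD x t Hxt). }
    assert (Hd1 : forall s t, T s -> T t -> Derive alpha s = Derive alpha t).
    { apply constant_of_derive_zero.
      - intros t1 t t2 [x1 H1] [x2 H2]. now apply (HMt x1 x2 t1 t t2).
      - intros t Ht. split; [|now apply Hdet]. destruct Ht as [x Hxt].
        destruct HX as [[_ [_ Sp]] _].
        apply (smooth_theta_ex_derive M (phi X) alpha x t); auto.
        intros p Hp. now apply E. }
    (* The coefficient is the constant value of the derivative of [alpha], read at any [t0] in [T].
       If [T] is empty then so is [M], and any coefficient serves. *)
    destruct (classic (exists t, T t)) as [[t0 Ht0]|Hempty].
    + exists (Derive alpha t0). intros [x t] Hxt.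
      assert (Ht : T t) by (exists x; exact Hxt).
      destruct (E _ Hxt) as [-> [-> ->]]. simpl. repeat split.
      rewrite (Hd1 t0 t Ht0 Ht). now apply Hdet.
    + exists 0. intros [x t] Hxt. destruct Hempty. now exists t, x.
  - intros [c E].
    split; [|now exists (fun t => c * t)].
    (* [X] is only known to agree with the linear field on [M], so its smoothness and invariance are
       carried over from that model. *)
    apply (infinitesimal_symmetry_ext M 2 _ (theta_field (fun t => c * t)));
      [exact HM| |apply linear_field_symmetry].
    intros p Hp. destruct (E p Hp) as [-> [-> ->]]. easy.
Qed.
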